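(* Let $X\in\mathcal{C}_1$ be a circular graph containing at least one particle of each type, i.e. there is a vertex $u$ of $X$ with $a_1(u)=1$ and there is a vertex $v$ of $X$ with $b_1(v)=1$. For $n\in\mathbb{N}$ let $e_n=S'\left((\sqrt{\tau}\,I)^{-n}(X)\right)$. Then $(e_n)=\Theta(\log(n))$.
   Context: Names. Let $\mathbb{K}$ be a countable set. Names are terms $u,v ::= c \mid u.t \mid u\vee v$ with $c\in\mathbb{K}$, $t\in\{l,r\}^*$, modulo the equalities $(u\vee v).l=u$, $(u\vee v).r=v$, $u.\varepsilon=u$, $u.l\vee u.r=u$ ($\varepsilon$ the empty word). Circular graphs. An element $X$ of $\mathcal{C}_1$ consists of a finite nonempty set $V(X)$ of names such that for all $v,v'\in V(X)$ and $t,t'\in\{l,r\}^*$, $v.t=v'.t'$ implies $v=v'$ and $t=t'$; a set $E(X)$ of edges; and two bits $a_1(u),b_1(u)\in\{0,1\}$ for each vertex $u$. Each vertex $u$ has two ports $u:a$ and $u:b$; each edge has the form $\{u:b,v:a\}$, every port of every vertex belongs to exactly one edge, and the graph is connected, i.e. it is a single finite cycle (a one-vertex cycle has the single edge $\{u:b,u:a\}$). If $\{u:b,v:a\}\in E(X)$, think of $v$ as the right neighbour of $u$. The bit $a_1(u)=1$ (resp. $b_1(u)=1$) means that $u$ contains a particle about to move along port $a$ (resp. port $b$); these are the two types of particles. The number of particles of $X$ is the total number of bits equal to $1$. Entropy. For $X\in\mathcal{C}_1$ with $p$ particles, $S'(X)=\log\binom{2|V(X)|}{p}$. Step $\sqrt{\tau}$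 (each particle hops by half an edge along its port; edges become vertices and vertices become edges). $V(\sqrt{\tau}(X))=\{u.r\vee v.l \mid \{u:b,v:a\}\in E(X)\}$; for each $u\in V(X)$ with right neighbour $x$ and left neighbour $y$ (i.e. $\{u:b,x:a\},\{y:b,u:a\}\in E(X)$), there is an edge $\{y':b,x':a\}$ with $y'=y.r\vee u.l$ and $x'=u.r\vee x.l$; and the vertex $x'=u.r\vee v.l$ coming from the edge $\{u:b,v:a\}$ has bits $b_1(x')=b_1(u)$ and $a_1(x')=a_1(v)$. This is a bijection of $\mathcal{C}_1$, with $\sqrt{\tau}^{-1}=T\sqrt{\tau}T$ where $T$ exchanges the bits $a_1(u)$ and $b_1(u)$ at every vertex $u$. Step $I$. Synchronously everywhere in the graph: (split) every vertex $u$ with $a_1(u)=b_1(u)=1$ is replaced by two vertices $u.l,u.r$ joined by the edge $\{u.l:b,u.r:a\}$, where $u.l$ inherits the connection of port $a$ of $u$ and $u.r$ inherits the connection of port $b$ of $u$, with $a_1(u.l)=b_1(u.r)=1$ and $b_1(u.l)=a_1(u.r)=0$; (merge) every pair of vertices $u,v$ with $\{u:b,v:a\}\in E(X)$, $a_1(u)=b_1(v)=1$ and $b_1(u)=a_1(v)=0$ is replaced by one vertex $u\vee v$ with $a_1(u\vee v)=b_1(u\vee v)=1$, which inherits the connection of port $a$ of $u$ and the connection of port $b$ of $v$. Everything else is unchanged. These patterns do not overlap, and $I$ is an involution. $\sqrt{\tau}\,I$ is the composition applying $I$ first and then $\sqrt{\tau}$, so $(\sqrt{\tau}\,I)^{-1}=I^{-1}\sqrt{\tau}^{-1}=I\sqrt{\tau}^{-1}$,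 and $(\sqrt{\tau}\,I)^{-n}$ is its $n$-th iterate. For real sequences, $(u_n)=\Theta((v_n))$ means that there exist positive reals $a,b$ and $n_0\in\mathbb{N}$ such that for all $n\ge n_0$, $a\,v_n\le u_n\le b\,v_n$; ''$\Theta(\log(n))$'' is the case $v_n=\log(n)$. *)

(* Defs.v *)
From HB Require Import structures.
From mathcomp Require Import all_boot all_order all_algebra finmap.
From mathcomp Require Import boolp reals exp.

Set Implicit Arguments.
Unset Strict Implicit.
Unset Printing Implicit Defensive.

Import Order.TTheory GRing.Theory Num.Theory.

Local Open Scope fset_scope.
Local Open Scope quotient_scope.

(** * Names *)

(* Words over {l, r}, with l = false and r = true. *)
Definition word := seq bool.

Inductive term (K : Type) : Type :=
| Atom of K
| Proj of term K & word
| Join of term K & term K.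

Section TermCountable.
Variable K : countType.

Fixpoint term_encode (u : term K) : GenTree.tree (K + word) :=
  match u with
  | Atom c => GenTree.Leaf (inl c)
  | Proj u t => GenTree.Node 0 [:: term_encode u; GenTree.Leaf (inr t)]
  | Join u v => GenTree.Node 1 [:: term_encode u; term_encode v]
  end.

Fixpoint term_decode (x : GenTree.tree (K + word)) : option (term K) :=
  match x with
  | GenTree.Leaf (inl c) => Some (Atom c)
  | GenTree.Node 0 [:: x; GenTree.Leaf (inr t)] =>
      omap (fun u => Proj u t) (term_decode x)
  | GenTree.Node 1 [:: x; y] =>
      obind (fun u => omap (Join u) (term_decode y)) (term_decode x)
  | _ => None
  end.

Lemma term_encodeK : pcancel term_encode term_decode.
Proof. by elim=> //= [u -> t|u -> v ->]. Qed.

HB.instance Definition _ := Countable.copy (term K) (pcan_type term_encodeK).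

End TermCountable.

(* The congruence generated by the equational theory of names. The rule
   [teq_cat] makes [u.t] the iterated projection along the word [t], i.e. it
   identifies [(u.s).t] with [u.st]. *)
Inductive term_eq (K : Type) : term K -> term K -> Prop :=
| teq_refl u : term_eq u u
| teq_sym u v : term_eq u v -> term_eq v u
| teq_trans u v w : term_eq u v -> term_eq v w -> term_eq u w
| teq_Proj u v t : term_eq u v -> term_eq (Proj u t) (Proj v t)
| teq_Join u u' v v' :
    term_eq u u' -> term_eq v v' -> term_eq (Join u v) (Join u' v')
| teq_l u v : term_eq (Proj (Join u v) [:: false]) u
| teq_r u v : term_eq (Proj (Join u v) [:: true]) v
| teq_nil u : term_eq (Proj u [::]) u
| teq_eta u : term_eq (Join (Proj u [:: false]) (Proj u [:: true])) u
| teq_cat u s t : term_eq (Proj (Proj u s) t) (Proj u (s ++ t)).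

Section Names.
Variable K : countType.
Implicit Types u v : term K.

Definition term_eqb u v : bool := `[< term_eq u v >].

Lemma term_eqb_refl : reflexive term_eqb.
Proof. by move=> u; apply/asboolP; apply: teq_refl. Qed.

Lemma term_eqb_sym : symmetric term_eqb.
Proof. by move=> u v; apply/asboolP/asboolP; apply: teq_sym. Qed.

Lemma term_eqb_trans : transitive term_eqb.
Proof.
by move=> v u w /asboolP uv /asboolP vw; apply/asboolP; apply: teq_trans uv vw.
Qed.

Canonical term_equiv :=
  EquivRel term_eqb term_eqb_refl term_eqb_sym term_eqb_trans.

Definition name : Type := {eq_quot term_equiv}.

HB.instance Definition _ := Choice.on name.
HB.instance Definition _ := EqQuotient.on name.

Definition nproj (x : name) (t : word) : name := \pi_name (Proj (repr x) t).
Definition njoin (x y : name) : name := \pi_name (Join (repr x) (repr y)).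
Definition nl (x : name) : name := nproj x [:: false].
Definition nr (x : name) : name := nproj x [:: true].

Lemma name_eqP u v : \pi_name u = \pi_name v <-> term_eq u v.
Proof.
by split=> [/eqmodP/asboolP|uv]; [|apply/eqmodP; apply/asboolP].
Qed.

Lemma nproj_pi u t : nproj (\pi_name u) t = \pi_name (Proj u t).
Proof.
by apply/name_eqP; apply: teq_Proj; apply/name_eqP; rewrite reprK.
Qed.

Lemma njoin_pi u v : njoin (\pi_name u) (\pi_name v) = \pi_name (Join u v).
Proof.
by apply/name_eqP; apply: teq_Join; apply/name_eqP; rewrite reprK.
Qed.

Lemma nl_join (x y : name) : nl (njoin x y) = x.
Proof.
rewrite -(reprK x) -(reprK y) /nl njoin_pi nproj_pi; apply/name_eqP.
exact: teq_l.
Qed.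

Lemma nr_join (x y : name) : nr (njoin x y) = y.
Proof.
rewrite -(reprK x) -(reprK y) /nr njoin_pi nproj_pi; apply/name_eqP.
exact: teq_r.
Qed.

Lemma njoin_eta (x : name) : njoin (nl x) (nr x) = x.
Proof.
rewrite -(reprK x) /nl /nr !nproj_pi njoin_pi; apply/name_eqP.
exact: teq_eta.
Qed.

Lemma nproj_nil (x : name) : nproj x [::] = x.
Proof. by rewrite -(reprK x) nproj_pi; apply/name_eqP; apply: teq_nil. Qed.

Lemma nproj_cat (x : name) s t : nproj (nproj x s) t = nproj x (s ++ t).
Proof.
rewrite -(reprK x) !(nproj_pi (repr x)) nproj_pi; apply/name_eqP.
exact: teq_cat.
Qed.

End Names.

(** * Circular graphs *)

(* The edge {u:b, v:a} is encoded as the ordered pair [(u, v)]. The bit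
   functions a_1 and b_1 on vertices are encoded by the sets of vertices where
   they take the value 1. *)
Record graph (K : countType) := Graph {
  vertices : {fset name K};
  edges : {fset name K * name K};
  bit_a : {fset name K};
  bit_b : {fset name K}
}.

Definition adjacent (K : countType) (X : graph K) : rel (name K) :=
  fun u v => ((u, v) \in edges X) || ((v, u) \in edges X).

Record circular (K : countType) (X : graph K) : Prop := Circular {
  circular_nonempty : vertices X != fset0;
  circular_names : forall (v v' : name K) (t t' : word),
    v \in vertices X -> v' \in vertices X ->
    nproj v t = nproj v' t' -> v = v' /\ t = t';
  circular_bit_a : bit_a X `<=` vertices X;
  circular_bit_b : bit_b X `<=` vertices X;
  circular_edges : forall u v : name K,
    (u, v) \in edges X -> u \in vertices X /\ v \in vertices X;
  circular_port_b : forall u : name K,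
    u \in vertices X -> exists! v : name K, (u, v) \in edges X;
  circular_port_a : forall v : name K,
    v \in vertices X -> exists! u : name K, (u, v) \in edges X;
  circular_connected : forall u v : name K,
    u \in vertices X -> v \in vertices X ->
    exists2 p : seq (name K), path (adjacent X) u p & last u p = v
}.

Definition particles (K : countType) (X : graph K) : nat :=
  #|` bit_a X| + #|` bit_b X|.

Definition entropy (R : realType) (K : countType) (X : graph K) : R :=
  ln ('C(2 * #|` vertices X|, particles X)%:R)%R.

(** * Dynamics *)

Definition swap_bits (K : countType) (X : graph K) : graph K :=
  Graph (vertices X) (edges X) (bit_b X) (bit_a X).

Section Dynamics.
Variable K : countType.
Implicit Types (X : graph K) (u v : name K) (e : name K * name K).

Definition edge_name e : name K := njoin (nr e.1) (nl e.2).

Definition sqrt_tau X : graph K :=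
  Graph
    [fset edge_name e | e in edges X]
    [fset (edge_name d.1, edge_name d.2)
       | d in edges X `*` edges X & d.1.2 == d.2.1]
    [fset edge_name e | e in edges X & e.2 \in bit_a X]
    [fset edge_name e | e in edges X & e.1 \in bit_b X].

Definition sqrt_tau_inv X : graph K := swap_bits (sqrt_tau (swap_bits X)).

Definition splits X u : bool := (u \in bit_a X) && (u \in bit_b X).

Definition merges X e : bool :=
  [&& e \in edges X, e.1 \in bit_a X, e.2 \in bit_b X,
      e.1 \notin bit_b X & e.2 \notin bit_a X].

Definition split_set X : {fset name K} := [fset u in vertices X | splits X u].

Definition merge_set X : {fset name K * name K} :=
  [fset e in edges X | merges X e].

Definition fixed_set X : {fset name K} :=
  [fset u in vertices X | ~~ splits X u &
     all (fun e => (u != e.1) && (u != e.2)) (merge_set X)].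

(* The vertex that holds, after the step, the former connection of port a
   (resp. port b) of [u]. When [u] is the right (resp. left) half of a merged
   pair, that connection is the contracted edge and the value is irrelevant. *)
Definition heir_a X u : name K :=
  if splits X u then nl u else
  if [seq e <- merge_set X | e.1 == u] is e :: _ then njoin e.1 e.2 else u.

Definition heir_b X u : name K :=
  if splits X u then nr u else
  if [seq e <- merge_set X | e.2 == u] is e :: _ then njoin e.1 e.2 else u.

Definition step_I X : graph K :=
  let ls := [fset nl u | u in split_set X] in
  let rs := [fset nr u | u in split_set X] in
  let ms := [fset njoin e.1 e.2 | e in merge_set X] in
  let fs := fixed_set X in
  Graph
    (ls `|` rs `|` ms `|` fs)
    ([fset (nl u, nr u) | u in split_set X] `|`
     [fset (heir_b X e.1, heir_a X e.2) | e in edges X & ~~ merges X e])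
    (ls `|` ms `|` (bit_a X `&` fs))
    (rs `|` ms `|` (bit_b X `&` fs)).

Definition step X : graph K := sqrt_tau (step_I X).

(* The inverse of [step] on circular graphs: [step_I] is an involution and
   [sqrt_tau_inv] is inverse to [sqrt_tau]. *)
Definition step_inv X : graph K := step_I (sqrt_tau_inv X).

End Dynamics.

(** * Asymptotics *)

Definition is_Theta (R : realType) (u v : nat -> R) : Prop :=
  exists a b : R, (0 < a)%R /\ (0 < b)%R /\
  exists n0 : nat, forall n : nat, n0 <= n ->
    (a * v n <= u n)%R /\ (u n <= b * v n)%R.

(* Main.v *)
From HB Require Import structures.
Require Import Defs.
From mathcomp Require Import all_boot all_order all_algebra finmap.
From mathcomp Require Import boolp reals exp.
From mathcomp Require Import zify ring.

(* Backwards in time, an a-particle moves right and a b-particle moves left.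
   Once both sit on one vertex, that vertex splits, the two particles move back
   onto the edge between its halves, and the new vertex carries both again: it
   splits at every later step. Such a vertex eventually appears: without splits
   the graph cannot grow, and once merges have stopped too, the two species
   rotate past each other on a cycle of fixed size. Cutting the cycle there,
   every merge is the crossing of an a-particle with a b-particle to its right,
   after which the two drift apart for ever. Hence the size minus the number of
   pending crossings increases by at least one per step. The size also
   increases by at most one per a-particle, so the number of vertices is linear
   in n; and the entropy of p particles is then of order log n, since m <= C(m,
   p) <= m ^ p for 0 < p < m. *)

Set Implicit Arguments.
Unset Strict Implicit.
Unset Printing Implicit Defensive.

Import GRing.Theory Num.Theory.

Local Open Scope fset_scope.

(** * Edges of cyclic lists *)

(** [cedges] closes the list into a cycle, so that a single vertex gets its loop; [pedges] leaves
    out the pair from the last element back to the first. *)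
Definition cedges {T : Type} (s : seq T) : seq (T * T) := zip s (rot 1 s).
Definition pedges {T : Type} (s : seq T) : seq (T * T) := zip s (behead s).

Lemma zip_cons_rcons (T : Type) (x y : T) s :
  zip (x :: s) (rcons s y) = rcons (zip (x :: s) s) (last x s, y).
Proof. by elim: s x => [|z s IHs] x //=; rewrite IHs. Qed.

Section CyclicLists.
Variable T : eqType.
Implicit Types (s b : seq T) (bs : seq (seq T)).

Lemma cedges_cons x s :
  cedges (x :: s) =i (last x s, x) :: pedges (x :: s).
Proof.
by move=> e; rewrite /cedges /pedges rot1_cons zip_cons_rcons mem_rcons.
Qed.

Lemma pedges_cat x0 s1 s2 : s1 != [::] -> s2 != [::] ->
  pedges (s1 ++ s2) =i
  (last x0 s1, head x0 s2) :: pedges s1 ++ pedges s2.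
Proof.
case: s1 => // x s1 _; case: s2 => // y s2 _ e; rewrite /pedges /=.
elim: s1 x => [|z s1 IHs] x //=.
rewrite !in_cons IHs !in_cons.
by rewrite orbCA.
Qed.

Lemma pedges_flatten x0 bs : all (fun b => b != [::]) bs ->
  pedges (flatten bs) =i flatten (map pedges bs) ++
    [seq (last x0 p.1, head x0 p.2) | p <- pedges bs].
Proof.
elim: bs => [|b [|c bs] IHbs] //= /andP[b0 bsP] e.
  by rewrite !cats0.
have cbs0 : c ++ flatten bs != [::].
  by case: (c) bsP => // /andP[].
rewrite (pedges_cat x0) // in_cons mem_cat IHbs //= !mem_cat in_cons /=.
have -> : head x0 (c ++ flatten bs) = head x0 c by case: (c) bsP.
rewrite -!orbA; set A := (e == _); case: A; rewrite /= ?orbT //.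
Qed.

(** Separates the edges inside blocks from those leading from one block to the next. The step I
    contracts or creates only edges of the first kind. *)
Lemma cedges_flatten x0 bs : all (fun b => b != [::]) bs ->
  cedges (flatten bs) =i flatten (map pedges bs) ++
    [seq (last x0 p.1, head x0 p.2) | p <- cedges bs].
Proof.
case: bs => [|b bs] //= bsP e.
have /andP[b0 _] := bsP.
case: b b0 bsP => // x b _ bsP.
rewrite /= cedges_cons in_cons -/(flatten ((x :: b) :: bs)).
rewrite -[x :: b ++ flatten bs]/(flatten ((x :: b) :: bs)).
rewrite (pedges_flatten x0) // /cedges rot1_cons.
rewrite zip_cons_rcons map_rcons /= !mem_cat mem_rcons in_cons /=.
suff -> : last x (b ++ flatten bs) = last x0 (last (x :: b) bs).
  by rewrite orbCA.
elim: bs x b {bsP} (bsP) => [|c bs IHbs] x b /=; first by rewrite cats0.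
case: c => // y c /= bs0; rewrite last_cat /=; exact: IHbs.
Qed.

Lemma size_cedges s : size (cedges s) = size s.
Proof. by rewrite size1_zip // size_rot. Qed.

Lemma nth_rot1 x0 s i :
  i < size s -> nth x0 (rot 1 s) i = nth x0 s (i.+1 %% size s).
Proof.
case: s => // x s; rewrite rot1_cons nth_rcons /= ltnS leq_eqVlt.
by case/predU1P=> [->|lt_i]; rewrite ?ltnn ?eqxx ?modnn // lt_i modn_small.
Qed.

Lemma nth_cedges x0 s i : i < size s ->
  nth (x0, x0) (cedges s) i = (nth x0 s i, nth x0 s (i.+1 %% size s)).
Proof. by move=> lt_i; rewrite nth_zip ?size_rot // nth_rot1. Qed.

Lemma cedgesP x0 s e :
  reflect (exists2 i, i < size s & e = (nth x0 s i, nth x0 s (i.+1 %% size s)))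
          (e \in cedges s).
Proof.
apply: (iffP (nthP (x0, x0))) => [[i]|[i lt_i ->]].
  by rewrite size_cedges => lt_i <-; exists i; rewrite ?nth_cedges.
by exists i; rewrite ?size_cedges ?nth_cedges.
Qed.

Lemma mem_cedges s e : e \in cedges s -> e.1 \in s /\ e.2 \in s.
Proof.
case: s => [|x0 s]; first by case: e.
move=> /(cedgesP x0)[i lt_i ->] /=.
by rewrite !mem_nth // ltn_mod.
Qed.

Lemma cedges_inj s d e : uniq s -> d \in cedges s -> e \in cedges s ->
  d.1 = e.1 \/ d.2 = e.2 -> d = e.
Proof.
case: s => [|x0 s]; first by case: d.
set t := x0 :: s => ut /(cedgesP x0)[i lt_i ->] /(cedgesP x0)[j lt_j ->] /= de.
suff -> : i = j by [].
case: de => /(congr1 (index^~ t)); rewrite !index_uniq ?ltn_mod // => ij.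
move: lt_i lt_j ij; rewrite /= !ltnS (leq_eqVlt i) (leq_eqVlt j).
case/predU1P=> [->|lt_i] /predU1P[->|lt_j]; rewrite ?modnn ?modn_small //.
by case.
Qed.

Lemma uniq_flatten_block bs b c x : uniq (flatten bs) ->
  b \in bs -> c \in bs -> x \in b -> x \in c -> b = c.
Proof.
elim: bs => //= d bs IHbs; rewrite cat_uniq => /and3P[_ /hasPn dis ubs].
have {}dis e : e \in bs -> x \in e -> x \notin d.
  by move=> ebs xe; apply: dis; apply/flattenP; exists e.
rewrite !in_cons => /predU1P[->|bbs] /predU1P[->|cbs] // xb xc.
- by have := dis _ cbs xc; rewrite xb.
- by have := dis _ bbs xb; rewrite xc.
- exact: IHbs.
Qed.

End CyclicLists.

(** As vertices are distinct, a shared endpoint fixes the position of both edges. The right-hand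
    side is the way [sqrt_tau] selects its new edges. *)
Lemma cedges_cedges (T : eqType) (s : seq T) d : uniq s ->
  (d \in cedges (cedges s)) =
  [&& d.1 \in cedges s, d.2 \in cedges s & d.1.2 == d.2.1].
Proof.
case: s => [|x0 s0]; first by case: d.
set s := x0 :: s0 => us; have s_gt0 : 0 < size s by [].
apply/idP/and3P => [|[/(cedgesP x0)[i lt_i e1] /(cedgesP x0)[j lt_j e2]]].
  move=> dP; have [d1 d2] := mem_cedges dP; split=> //.
  move: dP => /(cedgesP (x0, x0))[i]; rewrite size_cedges => lt_i ->.
  by rewrite /= !nth_cedges ?ltn_mod.
rewrite e1 e2 /= => /eqP /(congr1 (index^~ s)).
rewrite !index_uniq // ?ltn_mod // => ij.
apply/(cedgesP (x0, x0)); exists i; rewrite size_cedges //.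
by case: d e1 e2 => d1 d2 /= -> ->; rewrite !nth_cedges ?ltn_mod // ij.
Qed.

Lemma cedges_map (T1 T2 : eqType) (f : T1 -> T2) s :
  cedges (map f s) = [seq (f e.1, f e.2) | e <- cedges s].
Proof.
rewrite /cedges -map_rot.
by elim: s (rot 1 s) => [|x s IHs] [|y t] //=; rewrite IHs.
Qed.

(** * Independent names *)

Section Names.
Variable K : countType.
Implicit Types (u v w x y : name K) (s : seq (name K)) (t : word).

Lemma nproj_nl u t : nproj (nl u) t = nproj u (false :: t).
Proof. by rewrite /nl nproj_cat. Qed.

Lemma nproj_nr u t : nproj (nr u) t = nproj u (true :: t).
Proof. by rewrite /nr nproj_cat. Qed.

Lemma nproj_join u v (c : bool) t :
  nproj (njoin u v) (c :: t) = nproj (if c then v else u) t.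
Proof.
by case: c; [rewrite -nproj_nr nr_join|rewrite -nproj_nl nl_join].
Qed.

(** The naming condition of [circular], transported to lists; [wfree] and [disj] are its parts for
    one name and for two. *)
Definition indep s : Prop := uniq s /\
  {in s &, forall u v t t', nproj u t = nproj v t' -> u = v /\ t = t'}.

Definition wfree u : Prop := injective (nproj u).
Definition disj u v : Prop := forall t t', nproj u t <> nproj v t'.

Lemma disj_sym u v : disj u v -> disj v u.
Proof. by move=> uv t t' /esym; apply: uv. Qed.

Lemma disj_nl u v : disj u v -> disj (nl u) v.
Proof. by move=> uv t t'; rewrite nproj_nl; apply: uv. Qed.

Lemma disj_nr u v : disj u v -> disj (nr u) v.
Proof. by move=> uv t t'; rewrite nproj_nr; apply: uv. Qed.

Lemma disj_join u v w : disj u w -> disj v w -> disj (njoin u v) w.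
Proof.
move=> uw vw t t'; case: t => [|c t]; last first.
  by rewrite nproj_join; case: c; [apply: vw|apply: uw].
move=> /(congr1 (fun x : name K => nproj x [:: false])).
by rewrite !nproj_cat nproj_join; apply: uw.
Qed.

Lemma disj_halves u : wfree u -> disj (nl u) (nr u).
Proof. by move=> fu t t'; rewrite nproj_nl nproj_nr => /fu. Qed.

Lemma wfree_nl u : wfree u -> wfree (nl u).
Proof. by move=> fu t t'; rewrite !nproj_nl => /fu []. Qed.

Lemma wfree_nr u : wfree u -> wfree (nr u).
Proof. by move=> fu t t'; rewrite !nproj_nr => /fu []. Qed.

(* Extending both words by one letter makes them nonempty, so that the
   projections descend into [u] or [v]. *)
Lemma wfree_join u v : wfree u -> wfree v -> disj u v -> wfree (njoin u v).
Proof.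
move=> fu fv uv t t' /(congr1 (fun x : name K => nproj x [:: false])).
rewrite !nproj_cat => e.
suff: t ++ [:: false] = t' ++ [:: false] by rewrite !cats1 => /rcons_inj[].
have: t ++ [:: false] != [::] by case: (t).
have: t' ++ [:: false] != [::] by case: (t').
case: (t ++ _) (t' ++ _) e => [|c r] [|d r'] //.
rewrite !nproj_join; case: c d => -[] /= e _ _.
- by rewrite (fv _ _ e).
- by case: (uv _ _ (esym e)).
- by case: (uv _ _ e).
- by rewrite (fu _ _ e).
Qed.

Lemma indep_cons u s :
  indep (u :: s) <-> [/\ wfree u, {in s, forall v, disj u v} & indep s].
Proof.
split=> [[/= /andP[us s_uniq] sP]|[fu us [s_uniq sP]]].
  split.
  - by move=> t t' /sP []; rewrite ?mem_head.
  - move=> v vs t t' /sP []; rewrite ?mem_head ?in_cons ?vs ?orbT // => uv _.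
    by rewrite uv vs in us.
  - by split=> // v w vs ws; apply: sP; rewrite in_cons ?vs ?ws orbT.
split=> [|v w].
  by rewrite /= s_uniq andbT; apply/negP => /us /(_ [::] [::]).
rewrite !in_cons => /predU1P[->|vs] /predU1P[->|ws] t t' e.
- by split=> //; apply: fu.
- by case: (us _ ws t t').
- by case: (us _ vs t' t); rewrite e.
- exact: sP.
Qed.

Lemma indep_cat s1 s2 : indep (s1 ++ s2) <->
  [/\ indep s1, indep s2 & {in s1 & s2, forall u v, disj u v}].
Proof.
elim: s1 => [|u s1 IHs]; first by split=> [?|[]//]; split.
rewrite cat_cons; split=> [/indep_cons[fu us /IHs[i1 i2 d]]|[]].
  split=> //.
    by apply/indep_cons; split=> // v vs; apply: us; rewrite mem_cat vs.
  move=> v w; rewrite in_cons => /predU1P[->|vs] ws; last exact: d.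
  by apply: us; rewrite mem_cat ws orbT.
move=> /indep_cons[fu us i1] i2 d; apply/indep_cons; split=> //.
  move=> v; rewrite mem_cat => /orP[/us//|vs].
  by apply: d; rewrite ?mem_head.
by apply/IHs; split=> // v w vs ws; apply: d; rewrite // in_cons vs orbT.
Qed.

Lemma eq_indep s1 s2 : perm_eq s1 s2 -> indep s1 -> indep s2.
Proof.
move=> eqs [us sP]; split; first by rewrite -(perm_uniq eqs).
by move=> u v; rewrite -!(perm_mem eqs); apply: sP.
Qed.

(** A nonempty projection of an edge name lies in the right half of its source or in the left half
    of its target. Independence recovers the side and the endpoint, and either endpoint determines
    an edge of a cycle. *)
Lemma indep_edge_names s : indep s -> indep (map (@edge_name K) (cedges s)).
Proof.
move=> [us sP]; have eP : {in cedges s &, forall d e t t',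
    nproj (edge_name d) t = nproj (edge_name e) t' -> d = e /\ t = t'}.
  move=> d e ds es t t' /(congr1 (fun x : name K => nproj x [:: false])).
  rewrite !nproj_cat => E.
  suff [-> ] : d = e /\ t ++ [:: false] = t' ++ [:: false].
    by rewrite !cats1 => /rcons_inj[].
  have [[d1 d2] [e1 e2]] := (mem_cedges ds, mem_cedges es).
  have: t ++ [:: false] != [::] by case: (t).
  have: t' ++ [:: false] != [::] by case: (t').
  case: (t ++ _) (t' ++ _) E => [|c r] [|c' r'] //.
  rewrite !nproj_join; case: c c' => -[]; rewrite ?nproj_nl ?nproj_nr => E _ _.
  - have [de [->]] := sP _ _ d2 e2 _ _ E.
    by rewrite (cedges_inj us ds es) //; right.
  - by have [] := sP _ _ d2 e1 _ _ E.
  - by have [] := sP _ _ d1 e2 _ _ E.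
  - have [de [->]] := sP _ _ d1 e1 _ _ E.
    by rewrite (cedges_inj us ds es) //; left.
split.
  rewrite map_inj_in_uniq ?zip_uniql ?size_rot // => d e ds es de.
  by have [] := eP d e ds es [::] [::]; rewrite ?de.
move=> _ _ /mapP[d ds ->] /mapP[e es ->] t t' E.
by have [-> ->] := eP d e ds es _ _ E.
Qed.

End Names.

(** * Circular graphs as cyclic lists *)

Section Representation.
Variable K : countType.

Definition cell : Type := (name K * (bool * bool))%type.
HB.instance Definition _ := Equality.on cell.

Implicit Types (X Y : graph K) (s : seq cell) (x y : cell) (e : cell * cell).

(** The list goes once round the cycle, leaving each vertex by port b, from an arbitrary starting
    point; the cells carry the bits. *)
Record rep X s : Prop := Rep {
  rep_indep : indep (map fst s);
  rep_vertices : vertices X =i map fst s;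
  rep_edges : edges X =i [seq (e.1.1, e.2.1) | e <- cedges s];
  rep_bit_a : bit_a X =i [seq x.1 | x <- s & x.2.1];
  rep_bit_b : bit_b X =i [seq x.1 | x <- s & x.2.2]
}.

Lemma cell_inj s :
  uniq (map fst s) -> {in s &, injective (fst : cell -> name K)}.
Proof.
elim: s => //= x s IHs /andP[xs /IHs{}IHs] y z.
rewrite !in_cons => /predU1P[->|ys] /predU1P[->|zs] // e; last exact: IHs.
  by rewrite e map_f in xs.
by rewrite -e map_f in xs.
Qed.

Lemma mem_bits s x (p : pred cell) : uniq (map fst s) -> x \in s ->
  (x.1 \in [seq y.1 | y <- s & p y]) = p x.
Proof.
move=> us xs; apply/mapP/idP => [[y]|px]; last first.
  by exists x; rewrite ?mem_filter ?px.
by rewrite mem_filter => /andP[py ys] /(cell_inj us xs ys) ->.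
Qed.

Lemma rep_bit_aE X s x : rep X s -> x \in s -> (x.1 \in bit_a X) = x.2.1.
Proof. by case=> -[us _] _ _ -> _ xs; rewrite (mem_bits _ us). Qed.

Lemma rep_bit_bE X s x : rep X s -> x \in s -> (x.1 \in bit_b X) = x.2.2.
Proof. by case=> -[us _] _ _ _ -> xs; rewrite (mem_bits _ us). Qed.

Definition count_a s := count (fun x : cell => x.2.1) s.
Definition count_b s := count (fun x : cell => x.2.2) s.

Lemma card_rep X s : rep X s ->
  #|` vertices X| = size s /\ particles X = (count_a s + count_b s)%N.
Proof.
case=> -[us _] Xv _ Xa Xb.
have cardE (A : {fset name K}) r : uniq r -> A =i r -> #|` A| = size r.
  by move=> ur AE; apply/perm_size/uniq_perm.
split; first by rewrite (cardE _ _ us Xv) size_map.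
rewrite /particles (cardE _ _ _ Xa) ?(cardE _ _ _ Xb) ?size_map ?size_filter //.
all: by apply: subseq_uniq us; apply: map_subseq; apply: filter_subseq.
Qed.

Lemma zip_rot (S T : Type) n (s : seq S) (t : seq T) :
  size s = size t -> zip (rot n s) (rot n t) = rot n (zip s t).
Proof.
move=> st; set p := zip s t.
have -> : s = unzip1 p by rewrite unzip1_zip ?st.
have -> : t = unzip2 p by rewrite unzip2_zip ?st.
by rewrite -!map_rot zip_unzip.
Qed.

Lemma cedges_rot (T : eqType) (s : seq T) n : cedges (rot n s) =i cedges s.
Proof.
by move=> e; rewrite /cedges rot_rot zip_rot ?size_rot // mem_rot.
Qed.

Lemma rep_rot X s n : rep X s -> rep X (rot n s).
Proof.
case=> i v e a b; split.
- by apply: eq_indep i; rewrite perm_sym map_rot perm_rot.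
- by move=> u; rewrite v map_rot mem_rot.
- move=> d; rewrite e; apply: eq_mem_map => c; exact/esym/cedges_rot.
- by move=> u; rewrite a; apply: eq_mem_map => c; rewrite !mem_filter mem_rot.
- by move=> u; rewrite b; apply: eq_mem_map => c; rewrite !mem_filter mem_rot.
Qed.

(** [sqrt_tau_inv] on lists: the vertex made from an edge receives the a-bit of the left end and the
    b-bit of the right end. *)
Definition shift s : seq cell :=
  [seq (edge_name (e.1.1, e.2.1), (e.1.2.1, e.2.2.2)) | e <- cedges s].

Lemma rep_sqrt_tau_inv X s : rep X s -> rep (sqrt_tau_inv X) (shift s).
Proof.
move=> rX; have [[us sP] v e a b] := rX.
have shiftE : map fst (shift s) = map (@edge_name K) (cedges (map fst s)).
  by rewrite cedges_map -!map_comp.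
split=> /=.
- by rewrite shiftE; apply: indep_edge_names.
- move=> u; rewrite shiftE; apply/imfsetP/mapP => -[d] /= dP ->; exists d => //.
    by rewrite cedges_map -e.
  by rewrite e -cedges_map.
- move=> d.
  have -> : [seq (f.1.1, f.2.1) | f <- cedges (shift s)] =
      [seq (edge_name f.1, edge_name f.2) | f <- cedges (cedges (map fst s))].
    transitivity (cedges (map fst (shift s))).
      exact/esym/(cedges_map fst).
    by rewrite shiftE (cedges_map (@edge_name K)).
  apply/imfsetP/mapP => -[f] /= fP ->; exists f => //.
    rewrite cedges_cedges // cedges_map -!e.
    by move: fP; rewrite !inE /= -andbA.
  by rewrite !inE /= -andbA !e -cedges_map -cedges_cedges.
- move=> u; apply/imfsetP/mapP => /= -[f].
    rewrite !inE e => /andP[/mapP[d ds ->] /= da] ->.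
    exists (edge_name (d.1.1, d.2.1), (d.1.2.1, d.2.2.2)) => //.
    have [d1 d2] := mem_cedges ds.
    rewrite mem_filter; apply/andP; split; last by apply/mapP; exists d.
    by rewrite /= -(rep_bit_aE rX d1).
  rewrite mem_filter => /andP[fa /mapP[d ds fE]] ->.
  exists (d.1.1, d.2.1); last by rewrite fE.
  have [d1 d2] := mem_cedges ds; rewrite fE /= in fa.
  by rewrite !inE /= (rep_bit_aE rX d1) fa andbT e; apply/mapP; exists d.
- move=> u; apply/imfsetP/mapP => /= -[f].
    rewrite !inE e => /andP[/mapP[d ds ->] /= da] ->.
    exists (edge_name (d.1.1, d.2.1), (d.1.2.1, d.2.2.2)) => //.
    have [d1 d2] := mem_cedges ds.
    rewrite mem_filter; apply/andP; split; last by apply/mapP; exists d.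
    by rewrite /= -(rep_bit_bE rX d2).
  rewrite mem_filter => /andP[fa /mapP[d ds fE]] ->.
  exists (d.1.1, d.2.1); last by rewrite fE.
  have [d1 d2] := mem_cedges ds; rewrite fE /= in fa.
  by rewrite !inE /= (rep_bit_bE rX d2) fa andbT e; apply/mapP; exists d.
Qed.

End Representation.

Lemma cycle_cedges (T : eqType) (r : rel T) (s : seq T) d :
  cycle r s -> d \in cedges s -> r d.1 d.2.
Proof.
case: s => [|x s]; first by case: d.
rewrite /cedges rot1_cons /=; move: {1 3}x => y.
elim: s y => [|z s IHs] y /=.
  by rewrite andbT => ryx; rewrite inE => /eqP ->.
by case/andP=> ryz zs; rewrite inE => /predU1P[->|] //; apply: IHs.
Qed.

(** The port conditions make the right neighbour an injective self-map of a finite set.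
    Connectedness forces the orbit of one vertex to contain all vertices, and this orbit is the
    list. *)
Lemma circular_rep (K : countType) (X : graph K) :
  circular X -> exists s, rep X s.
Proof.
case=> V0 names Xa Xb EV portb porta conn.
have [v0 v0V] := fset0Pn _ V0.
pose V : finType := vertices X.
have next_ex (v : V) : exists w : V, (val v, val w) \in edges X.
  have [w [vw _]] := portb _ (valP v); have [_ wV] := EV _ _ vw.
  by exists [` wV].
pose f (v : V) : V := xchoose (next_ex v).
have fE (v : V) : (val v, val (f v)) \in edges X.
  exact: (xchooseP (next_ex v)).
have f_uniq (v : V) w : (val v, w) \in edges X -> w = val (f v).
  have [w' [_ uw']] := portb _ (valP v) => vw.
  by rewrite -(uw' _ vw) (uw' _ (fE v)).
have f_inj : injective f.
  move=> u v uv; apply: val_inj; have [w [_ uw]] := porta _ (valP (f u)).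
  by rewrite -(uw _ (fE u)); apply: uw; rewrite uv.
pose x0 : V := [` v0V]; pose o := orbit f x0.
have o_all (v : V) : v \in o.
  rewrite -fconnect_orbit.
  have [p xp pv] := conn _ _ v0V (valP v).
  suff [w pw xw] : exists2 w : V, last v0 p = val w & fconnect f x0 w.
    by have -> : v = w by apply: val_inj; rewrite -pw pv.
  move: xp {pv}.
  rewrite -[v0]/(val x0); elim: p (x0) => [|y p IHp] x /=.
    by exists x; rewrite ?connect0.
  case/andP=> xy yp.
  have [z yz xz] : exists2 z : V, y = val z & fconnect f x z.
    case/orP: xy => [xy|yx].
      by exists (f x); [apply: f_uniq|apply: fconnect1].
    have [yV _] := EV _ _ yx; exists [` yV] => //.
    (* An edge followed backwards stays in the orbit: [f] is a permutation, so reachability is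
       symmetric. *)
    rewrite fconnect_sym //; have -> : x = f [` yV]; last exact: fconnect1.
    by apply/val_inj/f_uniq.
  rewrite yz in yp *; have [w -> zw] := IHp _ yp.
  by exists w => //; apply: connect_trans zw.
pose c (v : V) : cell K := (val v, (val v \in bit_a X, val v \in bit_b X)).
have mapE : map fst (map c o) = map val o by rewrite -map_comp.
have u_o : uniq (map val o) by rewrite (map_inj_uniq val_inj) orbit_uniq.
have memV u : (u \in map val o) = (u \in vertices X).
  apply/mapP/idP => [[v _ ->]|uV]; first exact: valP.
  by exists [` uV].
have bitE (A : {fset name K}) (p : pred (cell K)) : A `<=` vertices X ->
    (forall v : V, p (c v) = (val v \in A)) ->
    A =i [seq x.1 | x <- map c o & p x].
  move=> /fsubsetP AV pE u; apply/idP/mapP => [uA|[x]].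
    exists (c [` AV _ uA]) => //; rewrite mem_filter pE uA /=.
    by rewrite map_f.
  by rewrite mem_filter => /andP[px /mapP[v _ xE]] ->; rewrite xE pE in px *.
exists (map c o); split.
- rewrite mapE; split=> // u v; rewrite !memV => uV vV t t'; exact: names.
- by move=> u; rewrite mapE memV.
- move=> d; rewrite cedges_map -map_comp; apply/idP/mapP => [dE|[e eo ->]] /=.
    case: d dE => u v uv; have [uV _] := EV _ _ uv.
    have: [` uV] \in o by [].
    case/(nthP x0) => i lt_i ui.
    pose e := (nth x0 o i, nth x0 o (i.+1 %% size o)).
    have eo : e \in cedges o by apply/(cedgesP x0); exists i.
    exists e => //=; have /eqP := cycle_cedges (cycle_orbit f_inj x0) eo.
    by rewrite /= ui => <-; rewrite -(f_uniq [` uV] v).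
  have /eqP <- := cycle_cedges (cycle_orbit f_inj x0) eo.
  exact: fE.
- exact: bitE.
- exact: bitE.
Qed.

(** * The step I on cyclic lists *)

Section Blocks.
Variable K : countType.
Implicit Types (X : graph K) (x y : cell K) (b : seq (cell K)).
Implicit Types bs : seq (seq (cell K)).

Definition both x : bool := x.2.1 && x.2.2.

Definition mergeable x y : bool := [&& x.2.1, y.2.2, ~~ x.2.2 & ~~ y.2.1].

(** Blocks are the units on which I acts independently: a pair to merge, or a single vertex to split
    or to keep. *)
Definition block_wf b : bool :=
  match b with
  | [:: _] => true
  | [:: x; y] => mergeable x y
  | _ => false
  end.

Definition block_step b : seq (cell K) :=
  match b with
  | [:: x] =>
      if both x then [:: (nl x.1, (true, false)); (nr x.1, (false, true))]
      else [:: x]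
  | [:: x; y] => [:: (njoin x.1 y.1, (true, true))]
  | _ => b
  end.

(** New names are halves or joins of old ones, hence stay apart from whatever the old ones were
    apart from. *)
Lemma disj_block_step b (u : name K) : block_wf b ->
  {in map fst b, forall v, disj v u} ->
  {in map fst (block_step b), forall v, disj v u}.
Proof.
case: b => [|x [|y [|]]] //=.
  case: ifP => _ _ xu v; [rewrite !inE|exact: xu].
  have {}xu := xu x.1 (mem_head _ _).
  by case/orP=> /eqP ->; [apply: disj_nl|apply: disj_nr].
move=> _ xyu v; rewrite inE => /eqP ->.
by apply: disj_join; apply: xyu; rewrite !inE eqxx ?orbT.
Qed.

Lemma indep1 (u : name K) : wfree u -> indep [:: u].
Proof. by move=> fu; apply/indep_cons; split=> //; split. Qed.

Lemma indep_block_step b : block_wf b ->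
  indep (map fst b) -> indep (map fst (block_step b)).
Proof.
case: b => [|x [|y [|]]] //=.
  case: ifP => // _ _ /indep_cons[fx _ _]; apply/indep_cons; split.
  - exact: wfree_nl.
  - by move=> v; rewrite inE => /eqP ->; apply: disj_halves.
  - exact/indep1/wfree_nr.
move=> _ /indep_cons[fx xy /indep_cons[fy _ _]]; apply/indep1/wfree_join => //.
by apply: xy; rewrite inE.
Qed.

Lemma indep_flatten_step bs : all block_wf bs ->
  indep (map fst (flatten bs)) ->
  indep (map fst (flatten (map block_step bs))).
Proof.
elim: bs => //= b bs IHbs /andP[bP bsP]; rewrite !map_cat.
case/indep_cat=> ib ibs d; apply/indep_cat; split.
- exact: indep_block_step.
- exact: IHbs.
move=> u v ub; rewrite map_flatten -map_comp => /flatten_mapP[c cbs vc].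
apply: (disj_block_step bP) ub => w wb.
apply/disj_sym; apply: (disj_block_step (allP bsP _ cbs)) vc => z zc.
apply/disj_sym/d => //; rewrite map_flatten; apply/flatten_mapP.
by exists c.
Qed.

Section StepI.
Variables (X : graph K) (x0 : cell K) (bs : seq (seq (cell K))).
Hypotheses (Xbs : rep X (flatten bs)) (bs_wf : all block_wf bs).
(** With no merge across a boundary, the two-cell blocks are exactly the pairs of [merge_set]. *)
Hypothesis bs_max :
  {in cedges bs, forall d, ~~ mergeable (last x0 d.1) (head x0 d.2)}.

Let s := flatten bs.

Let us : uniq (map fst s). Proof. by case: Xbs => -[]. Qed.

Let mem_block b x : b \in bs -> x \in b -> x \in s.
Proof. by move=> bbs xb; apply/flattenP; exists b. Qed.

Let block_inj b c x y : b \in bs -> c \in bs -> x \in b -> y \in c ->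
  x.1 = y.1 -> b = c /\ x = y.
Proof.
move=> bbs cbs xb yc xy.
have e : x = y by apply: (cell_inj us (mem_block bbs xb) (mem_block cbs yc)).
split=> //; rewrite -e in yc.
by apply: (uniq_flatten_block (map_uniq us)) xb yc.
Qed.

Let blocks_neq0 : all (fun b => b != [::]) bs.
Proof. by apply: sub_all bs_wf; case. Qed.

Let cedgesE e : (e \in cedges s) =
  ([:: e.1; e.2] \in bs) ||
  (e \in [seq (last x0 d.1, head x0 d.2) | d <- cedges bs]).
Proof.
rewrite (cedges_flatten x0 blocks_neq0) mem_cat; congr (_ || _).
apply/flatten_mapP/idP => [[b bbs]|bbs]; last first.
  by exists [:: e.1; e.2]; rewrite // /pedges /= inE; case: (e).
have := allP bs_wf _ bbs; case: b bbs => [|x [|y [|]]] //= bbs _.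
by rewrite inE => /eqP ->.
Qed.

Let mergesE e : e \in cedges s -> merges X (e.1.1, e.2.1) = mergeable e.1 e.2.
Proof.
move=> es; have [e1 e2] := mem_cedges es.
rewrite /merges /= !(rep_bit_aE Xbs) // !(rep_bit_bE Xbs) //.
suff -> : (e.1.1, e.2.1) \in edges X by [].
by rewrite (rep_edges Xbs); apply/mapP; exists e.
Qed.

Let pair_cedge x y : [:: x; y] \in bs -> (x, y) \in cedges s.
Proof. by rewrite cedgesE => ->. Qed.

Let merge_setP u :
  reflect (exists x y, [:: x; y] \in bs /\ u = (x.1, y.1)) (u \in merge_set X).
Proof.
rewrite !inE /=; apply: (iffP andP) => [[]|[x [y [xy ->]]]]; last first.
  have xyc := pair_cedge xy; rewrite (mergesE xyc) /=.
  split; last exact: (allP bs_wf _ xy).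
  by rewrite (rep_edges Xbs); apply/mapP; exists (x, y).
rewrite (rep_edges Xbs) => /mapP[e es ->]; rewrite mergesE // => em.
exists e.1, e.2; split=> //; move: es; rewrite cedgesE => /orP[//|/mapP[d ds]] ed.
by have := bs_max ds; rewrite ed /= in em *; rewrite em.
Qed.

Let splitsE x : x \in s -> splits X x.1 = both x.
Proof. by move=> xs; rewrite /splits (rep_bit_aE Xbs) ?(rep_bit_bE Xbs). Qed.

Let in_pairF x y : [:: x; y] \in bs -> (both x = false) * (both y = false).
Proof.
move/(allP bs_wf) => /= /and4P[_ _ /negbTE x2 /negbTE y1].
by rewrite /both x2 y1 andbF.
Qed.

Let split_setP u :
  reflect (exists2 x, [:: x] \in bs & both x /\ u = x.1) (u \in split_set X).
Proof.
rewrite !inE /= (rep_vertices Xbs).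
apply: (iffP andP) => [[/mapP[x xs ->]]|[x xbs [bx ->]]].
  rewrite splitsE // => bx; exists x => //.
  have [b bbs xb] := flattenP xs; have := allP bs_wf _ bbs.
  case: b bbs xb => [|y [|z [|]]] //= bbs; rewrite !inE.
    by move=> /eqP ->.
  by case/orP=> /eqP xE; rewrite xE !(in_pairF bbs) in bx.
have xs : x \in s by apply: mem_block xbs _; rewrite inE.
by rewrite splitsE // map_f.
Qed.

Let fixed_setP u :
  reflect (exists2 x, [:: x] \in bs & ~~ both x /\ u = x.1)
          (u \in fixed_set X).
Proof.
rewrite !inE /= (rep_vertices Xbs).
apply: (iffP and3P) => [[/mapP[x xs ->]]|[x xbs [bx ->]]].
  rewrite splitsE // => bx /allP mX; exists x => //.
  have [b bbs xb] := flattenP xs; have := allP bs_wf _ bbs.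
  case: b bbs xb => [|y [|z [|]]] //= bbs; rewrite !inE.
    by move=> /eqP ->.
  have /mX /= : (y.1, z.1) \in merge_set X by apply/merge_setP; exists y, z.
  by case/andP=> yx zx /orP[] /eqP xE; rewrite xE eqxx in yx zx.
have xs : x \in s by apply: mem_block xbs _; rewrite inE.
rewrite map_f // splitsE //; split=> //.
apply/allP => e /merge_setP[y [z [yz ->]]] /=.
have x1 : x \in [:: x] by rewrite inE.
apply/andP; split; apply/eqP => xy.
  have [|//] := block_inj xbs yz x1 _ xy; by rewrite inE eqxx.
have [|//] := block_inj xbs yz x1 _ xy; by rewrite !inE eqxx orbT.
Qed.

(** The outer port a of a block sits on its first cell, both before and after the step; [heir_bE] is
    the mirror image for port b and the last cell. *)
Let heir_aE b : b \in bs -> heir_a X (head x0 b).1 = (head x0 (block_step b)).1.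
Proof.
move=> bbs; have := allP bs_wf _ bbs; rewrite /heir_a.
case: b bbs => [|x [|y [|]]] //= bbs xyP.
  rewrite splitsE; last by apply: mem_block bbs _; rewrite inE.
  case: ifP => // bx; case E : (filter _ _) => [//|e es].
  have: e \in e :: es by rewrite mem_head.
  rewrite -E mem_filter => /andP[/eqP ex /merge_setP[y [z [yz eE]]]].
  rewrite eE /= in ex.
  by have [] := block_inj yz bbs (mem_head _ _) (mem_head _ _) ex.
rewrite splitsE; last by apply: mem_block bbs _; rewrite mem_head.
rewrite (in_pairF bbs); case E : (filter _ _) => [|e es].
  have : (x.1, y.1) \in [seq e <- merge_set X | e.1 == x.1].
    by rewrite mem_filter eqxx; apply/merge_setP; exists x, y.
  by rewrite E.
have: e \in e :: es by rewrite mem_head.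
rewrite -E mem_filter => /andP[/eqP ex /merge_setP[z [w [zw eE]]]].
rewrite eE /= in ex *.
by have [[_ ->] ->] := block_inj zw bbs (mem_head _ _) (mem_head _ _) ex.
Qed.

Let heir_bE b : b \in bs -> heir_b X (last x0 b).1 = (last x0 (block_step b)).1.
Proof.
move=> bbs; have := allP bs_wf _ bbs; rewrite /heir_b.
have y2 (y z : cell K) : z \in [:: y; z] by rewrite !inE eqxx orbT.
case: b bbs => [|x [|y [|]]] //= bbs xyP.
  rewrite splitsE; last by apply: mem_block bbs _; rewrite inE.
  case: ifP => // bx; case E : (filter _ _) => [//|e es].
  have: e \in e :: es by rewrite mem_head.
  rewrite -E mem_filter => /andP[/eqP ex /merge_setP[y [z [yz eE]]]].
  rewrite eE /= in ex.
  by have [] := block_inj yz bbs (y2 _ _) (mem_head _ _) ex.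
rewrite splitsE; last exact: mem_block bbs (y2 _ _).
rewrite (in_pairF bbs); case E : (filter _ _) => [|e es].
  have : (x.1, y.1) \in [seq e <- merge_set X | e.2 == y.1].
    by rewrite mem_filter eqxx; apply/merge_setP; exists x, y.
  by rewrite E.
have: e \in e :: es by rewrite mem_head.
rewrite -E mem_filter => /andP[/eqP ex /merge_setP[z [w [zw eE]]]].
rewrite eE /= in ex *.
by have [[-> _] ->] := block_inj zw bbs (y2 _ _) (y2 _ _) ex.
Qed.

Let step_cells (p : pred (cell K)) u :
  reflect (exists b, b \in bs /\ exists2 x, x \in block_step b & p x /\ u = x.1)
    (u \in [seq x.1 | x <- flatten (map block_step bs) & p x]).
Proof.
apply: (iffP mapP) => [[x]|[b [bbs [x xb [px ->]]]]].
  rewrite mem_filter => /andP[px /flatten_mapP[b bbs xb] ->].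
  by exists b; split=> //; exists x.
by exists x => //; rewrite mem_filter px; apply/flatten_mapP; exists b.
Qed.

Let block_cases b : b \in bs ->
  [\/ exists2 x, b = [:: x] & both x, exists2 x, b = [:: x] & ~~ both x
    | exists x y, b = [:: x; y]].
Proof.
move/(allP bs_wf); case: b => [|x [|y [|]]] //= _.
  by case bx : (both x); [constructor 1|constructor 2]; exists x; rewrite ?bx.
by constructor 3; exists x, y.
Qed.

Lemma rep_step_I : rep (step_I X) (flatten (map block_step bs)).
Proof.
have both_step x : both x -> block_step [:: x] =
    [:: (nl x.1, (true, false)); (nr x.1, (false, true))].
  by rewrite /= => ->.
have single_step x : ~~ both x -> block_step [:: x] = [:: x].
  by rewrite /= => /negbTE ->.
have nlP u : reflect (exists2 x, [:: x] \in bs & both x /\ u = nl x.1)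
                     (u \in [fset nl u | u in split_set X]).
  apply: (iffP (imfsetP _ _ _ _)) => -[x] /=.
    by move=> /split_setP[y ybs [by_ ->]] ->; exists y.
  by move=> xbs [bx ->]; exists x.1 => //; apply/split_setP; exists x.
have nrP u : reflect (exists2 x, [:: x] \in bs & both x /\ u = nr x.1)
                     (u \in [fset nr u | u in split_set X]).
  apply: (iffP (imfsetP _ _ _ _)) => -[x] /=.
    by move=> /split_setP[y ybs [by_ ->]] ->; exists y.
  by move=> xbs [bx ->]; exists x.1 => //; apply/split_setP; exists x.
have njoinP u : reflect (exists x y, [:: x; y] \in bs /\ u = njoin x.1 y.1)
                        (u \in [fset njoin e.1 e.2 | e in merge_set X]).
  apply: (iffP (imfsetP _ _ _ _)) => [[e] /=|[x [y [xy ->]]]].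
    by move=> /merge_setP[x [y [xy ->]]] ->; exists x, y.
  by exists (x.1, y.1) => //; apply/merge_setP; exists x, y.
(* The vertex set and the two bit sets are assembled from the same four pieces. The booleans tell
   which of the left halves, right halves and joins are included, and [A] selects among the fixed
   vertices. *)
have vE (A : {fset name K}) (p : pred (cell K)) (pl pr pj : bool) :
    (forall u, p (u, (true, false)) = pl) ->
    (forall u, p (u, (false, true)) = pr) ->
    (forall u, p (u, (true, true)) = pj) ->
    (forall x, [:: x] \in bs -> (x.1 \in A) = p x) ->
    forall u,
    [|| pl && (u \in [fset nl u | u in split_set X]),
        pr && (u \in [fset nr u | u in split_set X]),
        pj && (u \in [fset njoin e.1 e.2 | e in merge_set X]) |
        (u \in A) && (u \in fixed_set X)] =
    (u \in [seq x.1 | x <- flatten (map block_step bs) & p x]).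
  move=> plE prE pjE pA u; apply/idP/step_cells.
    case/or4P=> /andP[].
    - move=> pl1 /nlP[x xbs [bx ->]]; exists [:: x]; split=> //.
      by exists (nl x.1, (true, false)); rewrite ?both_step ?mem_head ?plE.
    - move=> pr1 /nrP[x xbs [bx ->]]; exists [:: x]; split=> //.
      exists (nr x.1, (false, true)); rewrite ?both_step ?prE //.
      by rewrite !inE eqxx orbT.
    - move=> pj1 /njoinP[x [y [xy ->]]]; exists [:: x; y]; split=> //.
      by exists (njoin x.1 y.1, (true, true)); rewrite ?mem_head ?pjE.
    - move=> uA /fixed_setP[x xbs [bx ux]]; exists [:: x]; split=> //.
      by exists x; rewrite ?single_step ?mem_head // -pA // -ux.
  move=> [b [bbs [x xb [px ->]]]].
  case: (block_cases bbs) => [[y bE y2]|[y bE y1]|[y [z bE]]]; subst b.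
  - move: xb; rewrite both_step // !inE => /orP[]/eqP xE; subst x.
      by rewrite plE in px; rewrite px; apply/or4P; constructor 1; apply/nlP; exists y.
    by rewrite prE in px; rewrite px; apply/or4P; constructor 2; apply/nrP; exists y.
  - move: xb; rewrite single_step // inE => /eqP xE; subst x.
    apply/or4P; constructor 4; rewrite pA // px /=.
    by apply/fixed_setP; exists y.
  - move: xb; rewrite inE => /eqP xE; subst x.
    rewrite pjE in px; rewrite px /=; apply/or4P; constructor 3.
    by apply/njoinP; exists y, z.
have xs x : [:: x] \in bs -> x \in s.
  by move=> xbs; apply: mem_block xbs _; rewrite inE.
split.
- by apply: indep_flatten_step bs_wf _; case: Xbs.
- move=> u; rewrite -[flatten _]filter_predT.
  rewrite -(vE (vertices X) predT true true true) //; last first.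
    by move=> x /xs xs_; rewrite (rep_vertices Xbs) map_f.
  rewrite !inE /= -!orbA; do 3!congr (_ || _).
  by case: (_ \in vertices X).
- have step_neq0 : all (fun b => b != [::]) (map block_step bs).
    rewrite all_map; apply/allP => b bbs /=.
    case: (block_cases bbs) => [[x -> bx]|[x -> bx]|[x [y ->]]] //.
      by rewrite both_step.
    by rewrite single_step.
  (* An edge of the new list lies inside a stepped block, and then joins the halves of a split
     vertex, or runs between blocks, and then comes from an unmerged edge. *)
  move=> e; rewrite in_fsetU; apply/orP/mapP => [[]|[d]].
  + case/imfsetP=> u /= /split_setP[x xbs [bx ->]] ->.
    exists ((nl x.1, (true, false)), (nr x.1, (false, true))) => //.
    rewrite (cedges_flatten x0) // mem_cat; apply/orP; left.
    apply/flatten_mapP; exists (block_step [:: x]); first exact: map_f.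
    by rewrite both_step // inE.
  + case/imfsetP=> f /= /andP[+ nm] ->.
    rewrite (rep_edges Xbs) => /mapP[c cs fc]; move: nm.
    rewrite fc mergesE // => nm.
    move: (cs); rewrite cedgesE => /orP[/(allP bs_wf) /=|/mapP[d ds cE]].
      by rewrite (negbTE nm).
    exists (last x0 (block_step d.1), head x0 (block_step d.2)).
      rewrite (cedges_flatten x0) // mem_cat; apply/orP; right.
      by rewrite cedges_map -map_comp; apply/mapP; exists d.
    have [d1 d2] := mem_cedges ds.
    by rewrite cE /= heir_aE // heir_bE.
  + rewrite (cedges_flatten x0) // mem_cat => /orP[|].
      case/flatten_mapP => _ /mapP[b bbs ->] db ->; left.
      case: (block_cases bbs) => [[y bE y2]|[y bE y1]|[y [z bE]]]; subst b => //.
        move: db; rewrite both_step // inE => /eqP -> /=.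
        apply/imfsetP; exists y.1 => //; apply/split_setP; by exists y.
      by move: db; rewrite single_step.
    rewrite cedges_map -map_comp => /mapP[c cbs -> ->]; right.
    have [c1 c2] := mem_cedges cbs; have cm := bs_max cbs.
    have cs : (last x0 c.1, head x0 c.2) \in cedges s.
      by rewrite cedgesE; apply/orP; right; apply/mapP; exists c.
    apply/imfsetP; exists ((last x0 c.1).1, (head x0 c.2).1); last first.
      by rewrite /= heir_aE // heir_bE.
    rewrite !inE /= (mergesE cs) cm andbT (rep_edges Xbs).
    by apply/mapP; exists (last x0 c.1, head x0 c.2).
- move=> u; rewrite -(vE (bit_a X) _ true false true) //; last first.
    by move=> x /xs xs_; rewrite (rep_bit_aE Xbs).
  by rewrite !inE /= -!orbA.
- move=> u; rewrite -(vE (bit_b X) _ false true true) //; last first.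
    by move=> x /xs xs_; rewrite (rep_bit_bE Xbs).
  by rewrite !inE /= -!orbA.
Qed.

End StepI.
End Blocks.

(** * Growth of the inverse dynamics *)

Section Evolution.
Variable K : countType.
Implicit Types (X : graph K) (x y : cell K) (b s r : seq (cell K)).
Implicit Types bs : seq (seq (cell K)).

Definition block_maximal x0 bs : Prop :=
  {in cedges bs, forall d, ~~ mergeable (last x0 d.1) (head x0 d.2)}.

(** Greedy cutting from the left is maximal: the second cell of a merged pair holds no a-particle,
    so it cannot merge with its successor. *)
Lemma block_decomposition x0 s : exists bs,
  [/\ flatten bs = s, all (@block_wf K) bs
  & {in pedges bs, forall d, ~~ mergeable (last x0 d.1) (head x0 d.2)}].
Proof.
have [n] := ubnP (size s); elim: n s => // n IHn.
case=> [|x [|y s]] /=; rewrite ?ltnS => sn.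
- by exists [::].
- by exists [:: [:: x]]; split=> // d; rewrite inE.
have [xy|xy] := boolP (mergeable x y).
  have [bs [bsE wf mx]] := IHn s (ltnW sn).
  exists ([:: x; y] :: bs); split=> /=; rewrite ?bsE ?xy //.
  case: bs mx {bsE wf} => // b bs mx d; rewrite inE => /predU1P[->|/mx//] /=.
  by case/and4P: xy => _ _ _ y1; rewrite /mergeable (negbTE y1).
have [[|b bs] [bsE wf mx]] := IHn (y :: s) sn; first by [].
exists ([:: x] :: b :: bs); split=> //=; first by rewrite -bsE.
move=> d; rewrite inE => /predU1P[->|/mx//] /=.
by case: b bsE {mx} wf => //= z b [->].
Qed.

(** An a-particle on the first cell forbids a merge across the cut. *)
Lemma block_decomposition_cyclic x0 x s : x.2.1 ->
  exists bs, [/\ flatten bs = x :: s, all (@block_wf K) bs & block_maximal x0 bs].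
Proof.
move=> xa; have [[|b bs] [bsE wf mx]] := block_decomposition x0 (x :: s).
  by [].
exists (b :: bs); split=> // d; rewrite cedges_cons inE => /predU1P[->|/mx//] /=.
case: b bsE {mx} wf => //= y b [-> _] _.
by rewrite /mergeable xa andbF !andbF.
Qed.

Definition num_both s := count (@both K) s.

(* Pairs of an [a]-particle and a [b]-particle on the same vertex or further
   right: [step_I] preserves their number, and the shift removes those that lie
   on one vertex. *)
Fixpoint crossings s : nat :=
  if s is x :: s' then (x.2.1 * count_b s + crossings s')%N else 0%N.

Lemma crossings_cat s r :
  crossings (s ++ r) = (crossings s + crossings r + count_a s * count_b r)%N.
Proof.
elim: s => [|x s IHs] /=; first by rewrite mul0n addn0.
rewrite IHs /count_b count_cat /=; ring.
Qed.

(** A split trades one vertex with both particles for two without, and a merge does the reverse. In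
    both cases the a-particle and the b-particle form one crossing before and after. *)
Lemma block_step_stat b : block_wf b ->
  [/\ count_a (block_step b) = count_a b, count_b (block_step b) = count_b b,
      crossings (block_step b) = crossings b
    & (size (block_step b) + num_both (block_step b) = size b + num_both b)%N].
Proof.
case: b => [|[n1 [a1 b1]] [|[n2 [a2 b2]] [|]]] //=; rewrite /num_both /both /=.
  by case: a1 b1 => -[].
by rewrite /mergeable; case: a1 b1 a2 b2 => -[] [] [].
Qed.

Lemma flatten_step_stat bs : all (@block_wf K) bs ->
  let s := flatten bs in let r := flatten (map (@block_step K) bs) in
  [/\ count_a r = count_a s, count_b r = count_b s, crossings r = crossings s
    & (size r + num_both r = size s + num_both s)%N].
Proof.
elim: bs => //= b bs IHbs /andP[/block_step_stat[ba bb bc bn] /IHbs[sa sb sc sn]].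
rewrite /count_a /count_b /num_both !size_cat !count_cat !crossings_cat.
rewrite -!/(count_a _) -!/(count_b _) -!/(num_both _) ba sa bb sb bc sc.
by split=> //; lia.
Qed.

Lemma shift_stat s : [/\ size (shift s) = size s, count_a (shift s) = count_a s
  & count_b (shift s) = count_b s].
Proof.
rewrite size_map size_cedges; split=> //.
  rewrite /count_a count_map -[in RHS](@unzip1_zip _ _ s (rot 1 s)) ?size_rot //.
  by rewrite count_map.
have /permP es : perm_eq (rot 1 s) s by rewrite perm_rot.
rewrite /count_b count_map -es -[in RHS](@unzip2_zip _ _ s (rot 1 s)) ?size_rot //.
by rewrite count_map.
Qed.

(** The inverse dynamics regrouped to start with I, so that a vertex with both particles is seen
    just before its split and reappears after every round. *)
Definition evolve X := sqrt_tau_inv (step_I X).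

Lemma evolve_head X x s : rep X (x :: s) -> x.2.1 -> exists bs,
  [/\ flatten bs = x :: s, all (@block_wf K) bs, block_maximal x bs,
      rep (step_I X) (flatten (map (@block_step K) bs))
    & rep (evolve X) (shift (flatten (map (@block_step K) bs)))].
Proof.
move=> rX xa; have [bs [bsE wf mx]] := block_decomposition_cyclic x s xa.
have rI : rep (step_I X) (flatten (map (@block_step K) bs)).
  by apply: rep_step_I mx => //; rewrite bsE.
by exists bs; split=> //; apply: rep_sqrt_tau_inv.
Qed.

Lemma rep_head X s (p : pred (cell K)) : rep X s -> has p s ->
  exists x r, [/\ rep X (x :: r), p x & perm_eq (x :: r) s].
Proof.
move=> rX ps; pose i := find p s.
have lt_i : i < size s by rewrite -has_find.
case: s => [|x0 s] // in ps i lt_i rX *.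
set s' := x0 :: s in ps i lt_i rX *.
have E : rot i s' = nth x0 s' i :: (drop i.+1 s' ++ take i s').
  by rewrite /rot (drop_nth x0).
exists (nth x0 s' i), (drop i.+1 s' ++ take i s'); rewrite -E; split.
- exact: rep_rot.
- exact: nth_find.
- by rewrite perm_rot.
Qed.

(** Size plus [num_both] is conserved, so the growth is at most the number of vertices with both
    particles, hence at most the number of a-particles. *)
Lemma rep_step_I_ex X s : rep X s -> 0 < count_a s -> exists r,
  [/\ rep (step_I X) r, count_a r = count_a s, count_b r = count_b s
    & size r <= size s + count_a s].
Proof.
move=> rX; rewrite {1}/count_a -has_count => sa.
have [x [r [rX' xa xr]]] := rep_head rX sa.
have [bs [bsE wf _ rI _]] := evolve_head rX' xa.
have [ea eb _ en] := flatten_step_stat wf; rewrite bsE in ea eb en.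
set t := flatten _ in rI ea eb en; exists t; split=> //.
- by rewrite ea; apply/permP.
- by rewrite eb; apply/permP.
have [<- /permP ca] := (perm_size xr, xr).
have : num_both (x :: r) <= count_a (x :: r).
  by apply: sub_count => y /andP[].
rewrite /count_a ca -/(count_a s) => le.
by apply: leq_trans (leq_addr (num_both t) _) _; rewrite en leq_add2l.
Qed.

(** Outer induction on the size, inner induction on the distance [d] from an a-particle at the head
    to a b-particle on its right. While no vertex holds both, a round either merges a pair, which
    shortens the list, or only shifts, which brings the two particles closer. *)
Lemma ex_both X s : rep X s -> 0 < count_a s -> 0 < count_b s ->
  exists T y r, rep (iter T evolve X) (y :: r) /\ both y.
Proof.
have [n] := ubnP (size s); elim: n s X => // n IHn s X sn rX.
rewrite {1}/count_a {1}/count_b -!has_count => sa sb.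
have [x [s' [rX' xa xs]]] := rep_head rX sa.
rewrite -(perm_has _ xs) in sb; rewrite -(perm_size xs) in sn.
move: sb {rX sa xs s} => /(has_nthP x)[d].
elim: d x s' X xa rX' sn => [|d IHd] x s X xa rX sn ds db.
  by exists 0%N, x, s; split; rewrite // /both xa.
have [bs [bsE wf _ _ rG]] := evolve_head rX xa.
have [ea eb _ en] := flatten_step_stat wf; rewrite bsE in ea eb en.
set s' := flatten _ in rG ea eb en *; have [zs za zb] := shift_stat s'.
have [/rep_head|nb] := boolP (has (@both K) (x :: s)).
  by move/(_ _ rX) => [y [r [rY by_ _]]]; exists 0%N, y, r.
have nb0 : num_both (x :: s) = 0%N.
  by apply/eqP; rewrite -leqn0 leqNgt -has_count.
have [/eqP nb'|nb'] := boolP (num_both s' == 0%N).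
  (* Nothing splits, and a merge would leave a vertex with both particles, so I changes nothing. *)
  have s'E : s' = x :: s.
    rewrite /s' -[RHS]bsE; congr flatten; apply: map_id_in => b bbs.
    have := allP wf _ bbs; case: b bbs => [|y [|z [|]]] //= bbs _.
      case: ifP => // yb; case/hasP: nb; exists y => //.
      by rewrite -bsE; apply/flattenP; exists [:: y]; rewrite ?inE.
    have : has (@both K) s'.
      apply/hasP; exists (njoin y.1 z.1, (true, true)) => //.
      by apply/flatten_mapP; exists [:: y; z]; rewrite ?inE.
    by rewrite has_count -/(num_both _) nb'.
  have rG' : rep (evolve X) (shift (x :: s)) by rewrite -s'E.
  have szs : size (shift (x :: s)) = (size s).+1 by rewrite size_map size_cedges.
  have nthE : (nth x (shift (x :: s)) d).2.2.
    (* Cell [d] receives the b-bit of cell [d.+1], which is in range and needs no wrap-around, while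
       the a-particle keeps index 0. *)
    rewrite (nth_map (x, x)) ?size_cedges 1?ltnW // nth_cedges 1?ltnW //=.
    by rewrite modn_small.
  case shE : (shift (x :: s)) => [|y r] in rG' szs nthE *; first by [].
  have ya : y.2.1.
    by move: shE; rewrite /shift /cedges rot1_cons; case: (s) => [|? ?] /= [<- _].
  have [|| |T [z [t [rT zbo]]]] := IHd y r (evolve X) ya rG'.
  - by rewrite szs.
  - by rewrite szs ltnW.
  - by rewrite (set_nth_default x) // szs ltnW.
  - by exists T.+1, z, t; rewrite iterSr.
(* Some pair merged: [num_both] rose from zero while its sum with the size is conserved, so the size
   dropped. *)
have [| | | |T [z [t [rT zb']]]] := IHn (shift s') (evolve X) => //.
- rewrite zs -ltnS; apply: leq_trans sn; rewrite ltnS.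
  by move: en; rewrite nb0 addn0 => <-; rewrite -[ltnLHS]addn0 ltn_add2l lt0n.
- by rewrite za ea /= xa.
- rewrite zb eb /count_b -has_count; apply/(has_nthP x); by exists d.+1.
- by exists T.+1, z, t; rewrite iterSr.
Qed.

(** The shift lowers the index of every b-particle by one and keeps that of every a-particle, so a
    pair is lost exactly when it shares a vertex of [r]. A b-particle on [x] leaves through the cut,
    and [z], beyond the cut, brings none in. *)
Lemma crossings_shift x z r : z.2.2 = false ->
  (crossings [seq (edge_name (e.1.1, e.2.1), (e.1.2.1, e.2.2.2))
             | e <- zip (x :: r) (rcons r z)] + num_both r =
   x.2.1 * count_b r + crossings r)%N.
Proof.
move=> zb; elim: r x => [|y r IHr] x /=; first by rewrite zb !addn0.
have cE t u : count_b [seq (edge_name (e.1.1, e.2.1), (e.1.2.1, e.2.2.2))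
    | e <- zip (u :: t) (rcons t z)] = count_b t.
  elim: t u => [|v t IHt] u /=; first by rewrite zb.
  by rewrite IHt.
rewrite cE; have := IHr y; rewrite /num_both /both /=.
by case: (x.2.1); case: (y.2.1); case: (y.2.2) => /=; lia.
Qed.

(** The potential is the size of the tail minus its crossings. On the tail, I preserves the
    crossings and the size plus [num_both]; the shift then removes [num_both] crossings, and the
    split head contributes one more cell. *)
Lemma both_growth X y r m : rep X (y :: r) -> both y -> exists y' r',
  [/\ rep (iter m evolve X) (y' :: r'), both y'
    & m + size r + crossings r' <= size r' + crossings r].
Proof.
move=> rX by_; elim: m => [|m [x [s [rY bx sz]]]]; first by exists y, r.
have xa : x.2.1 by case/andP: bx.
have [bs [bsE wf _ _ rG]] := evolve_head rY xa.
case: bs bsE wf rG => //= b bs bsE /andP[bwf wf] rG.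
(* The head holds a b-particle, so it cannot be the left member of a merged pair. *)
have {bwf} bE : b = [:: x].
  case: b bsE bwf {rG} => [|z [|w [|]]] //= [-> _] // /and4P[_ _ xb _].
  by case/andP: bx => _; rewrite (negbTE xb).
rewrite bE /= bx /= in rG; rewrite bE /= in bsE; case: bsE => bsE.
have [_ _ ec en] := flatten_step_stat wf; rewrite bsE in ec en.
set s' := flatten _ in rG ec en *.
rewrite /shift /cedges rot1_cons /= in rG.
(* The right half of the head opens the list without an a-particle, and the left half closes it
   without a b-particle: no crossing enters through the cut. *)
have := crossings_shift (nr x.1, (false, true)) (z := (nl x.1, (true, false))) s' erefl.
rewrite mul0n add0n; set s'' := map _ _ in rG * => cs.
have sz'' : size s'' = (size s').+1.
  by rewrite size_map size1_zip // size_rcons.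
eexists; exists s''; split; first exact: rG.
- by [].
- move: sz en ec cs sz''.
  move: (size r) (size s) (size s') (size s''); lia.
Qed.

End Evolution.

(** * Linear bounds on the number of vertices *)

Section Growth.
Variable K : countType.
Implicit Types X : graph K.

Lemma iter_evolve X n :
  iter n (@evolve K) (sqrt_tau_inv X) = sqrt_tau_inv (iter n (@step_inv K) X).
Proof. by elim: n => //= n ->. Qed.

Lemma rep_iter X s n : rep X s -> 0 < count_a s -> exists r,
  [/\ rep (iter n (@step_inv K) X) r, count_a r = count_a s,
      count_b r = count_b s & size r <= size s + n * count_a s].
Proof.
move=> rX sa; elim: n => [|n [r [rr ra rb sz]]].
  by exists s; split; rewrite ?leq_addr.
have [szs ca cb] := shift_stat r.
have [|t [rt ta tb st]] := rep_step_I_ex (rep_sqrt_tau_inv rr).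
  by rewrite ca ra.
exists t; split=> //; rewrite ?ta ?tb ?ca ?cb //.
move: st; rewrite szs ca ra mulSn => st; apply: leq_trans st _.
by rewrite addnCA addnC leq_add2l.
Qed.

Lemma size_growth X s : rep X s -> 0 < count_a s -> 0 < count_b s ->
  exists c, forall n, n <= #|` vertices (iter n (@step_inv K) X)| + c.
Proof.
move=> rX sa sb; have [_ ca cb] := shift_stat s.
have := ex_both (rep_sqrt_tau_inv rX); rewrite ca cb => /(_ sa sb).
move=> [T [y [r [rY by_]]]].
(* [T] pays for the wait until a vertex holds both particles, and [crossings r] for the crossings
   pending at that time. *)
exists (T + crossings r)%N => n; have [lt_n|le_n] := ltnP n T.
  by rewrite addnCA; apply: leq_trans (ltnW lt_n) (leq_addr _ _).
have [t [rt _ _ _]] := rep_iter n rX sa.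
have [x [r' [rx _]]] := both_growth (n - T) rY by_.
rewrite -iterD subnK // iter_evolve in rx.
(* The half-step keeps the number of vertices, so the bound for [evolve] passes to [step_inv]. *)
have [-> _] := card_rep rt; have [szt _ _] := shift_stat t.
have [vx _] := card_rep rx; have [vt _] := card_rep (rep_sqrt_tau_inv rt).
move: vx; rewrite vt szt => -> /=; move: (size r) (size r'); lia.
Qed.

End Growth.

(** * Binomial bounds and the order of the entropy *)

(** In Pascal's rule one term is at least [m] by induction and the other is positive; the case where
    the lower index is one less than the upper is computed directly. *)
Lemma leq_bin m p : 0 < p < m -> m <= 'C(m, p).
Proof.
elim: m p => [|m IHm] [|p] //=; rewrite ltnS => pm.
rewrite binS; move: (pm); rewrite leq_eqVlt => /predU1P[<-|pm'].
  by rewrite binn binSn add1n.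
have /= := IHm p.+1; rewrite pm' => /(_ isT) mC.
by rewrite -addn1; apply: leq_add => //; rewrite bin_gt0 ltnW.
Qed.

Lemma bin_leq_exp m p : 'C(m, p) <= m ^ p.
Proof.
elim: m p => [|m IHm] [|p] //; rewrite ?bin0 ?expn0 // binS.
apply: leq_trans (leq_add (IHm _) (IHm _)) _.
by rewrite !expnS -mulSnr leq_mul2l; case: p => [|p] //; rewrite leq_exp2r ?leqnSn ?orbT.
Qed.

Theorem corollary2 (R : realType) (K : countType) (X : graph K)
    (hX : circular X)
    (ha : exists u : name K, u \in vertices X /\ u \in bit_a X)
    (hb : exists v : name K, v \in vertices X /\ v \in bit_b X) :
  is_Theta (fun n : nat => entropy R (iter n (@step_inv K) X))
           (fun n : nat => ln (n%:R : R)%R).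
Proof.
have [s rX] := circular_rep hX.
have sa : 0 < count_a s.
  rewrite /count_a -has_count; have [u [_]] := ha.
  rewrite (rep_bit_a rX) => /mapP[x]; rewrite mem_filter => /andP[xa xs] _.
  by apply/hasP; exists x.
have sb : 0 < count_b s.
  rewrite /count_b -has_count; have [u [_]] := hb.
  rewrite (rep_bit_b rX) => /mapP[x]; rewrite mem_filter => /andP[xb xs] _.
  by apply/hasP; exists x.
have [c Vc] := size_growth rX sa sb.
pose p := (count_a s + count_b s)%N.
have p_gt0 : 0 < p by rewrite addn_gt0 sa.
(* The binomial coefficient is eventually between [n] and the [p]-th power of the square of [n]. *)
exists 1%R, ((2 * p)%:R)%R; split; first exact: ltr01.
split; first by rewrite ltr0n muln_gt0.
(* The terms [2 * c + p] make [2 * size r] at least [n] and larger than [p]; the terms in [size s]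
   and [count_a s] make it at most the square of [n]. *)
exists (2 * c + p + 2 * size s + 2 * count_a s + 1)%N => n n_ge.
have [r [rr ra rb sz]] := rep_iter n rX sa.
have [vr pr] := card_rep rr; have := Vc n.
rewrite /entropy pr ra rb -/p vr => Vn.
have n_gt0 : 0 < n by lia.
have le_n : n <= 'C(2 * size r, p).
  apply: leq_trans (leq_bin _); lia.
have le_C : 'C(2 * size r, p) <= n ^ (2 * p).
  apply: leq_trans (bin_leq_exp _ _) _.
  rewrite expnM leq_exp2r // expnS expn1; nia.
have C_gt0 : 0 < 'C(2 * size r, p) by apply: leq_trans le_n.
rewrite mul1r; split.
  by rewrite ler_ln ?posrE ?ltr0n ?ler_nat.
have -> : ((2 * p)%:R * ln n%:R = ln ((n ^ (2 * p))%:R : R))%R.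
  by rewrite natrX lnXn ?ltr0n // mulr_natl.
by rewrite ler_ln ?posrE ?ltr0n ?ler_nat ?expn_gt0 ?n_gt0.
Qed.
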